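(* Assume that $g$ is $L_g$-Lipschitz continuous, i.e. $|g(z)-g(z')|\le L_g\|z-z'\|$ for all $z,z'\in\mathbb{R}^d$. Then the sequence $x_k$ generated by the composite conditional gradient algorithm with the approximate (multiplicative-error) linear minimization oracle described in the context, with $\delta\in(0,1]$ and with the modified parameters $\eta_k=\frac{2}{\delta(k-1)+2}$ and $\beta_k=\frac{\beta_0}{\sqrt{\delta k+1}}$, satisfies $$F(x_k)-F^\star\;\le\;\frac{2}{\delta}\left(\frac{D_{\mathcal{X}}^2L_f+\delta\mathcal{E}}{\delta k+1}+\frac{D_{\mathcal{X}}^2\|A\|^2}{\beta_0\sqrt{\delta k+1}}\right)+\frac{\beta_0L_g^2}{2\sqrt{\delta k+1}},$$ where $\mathcal{E}=F(x_1)-F^\star$. If $\delta$ is known, $\beta_0$ can be optimized from this bound.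
   Context: Problem: $\min_{x\in\mathcal{X}} F(x) := f(x)+g(Ax)$, where $\mathcal{X}\subset\mathbb{R}^n$ is nonempty, compact and convex; $f$ is a proper closed convex function, differentiable on $\mathcal{X}$ and $L_f$-smooth, i.e. $\|\nabla f(x)-\nabla f(x')\|\le L_f\|x-x'\|$ for all $x,x'\in\mathcal{X}$; $A\in\mathbb{R}^{d\times n}$; and $g$ is a proper closed convex function on $\mathbb{R}^d$ (possibly non-smooth). Norms of vectors are Euclidean, and $\|A\|$ is the spectral norm. The set of minimizers is assumed nonempty; $x^\star$ is a minimizer and $F^\star=F(x^\star)$. $D_{\mathcal{X}}=\max_{x,x'\in\mathcal{X}}\|x-x'\|$. Also $\mathrm{prox}_{\phi}(v)=\arg\min_x \phi(x)+\frac12\|x-v\|^2$. Algorithm with multiplicative-error oracle: given $x_1\in\mathcal{X}$, $\beta_0>0$, for $k=1,2,\dots$ set $\eta_k=\frac{2}{\delta(k-1)+2}$, $\beta_k=\frac{\beta_0}{\sqrt{\delta k+1}}$, $v_k=\beta_k\nabla f(x_k)+A^\top\big(Ax_k-\mathrm{prox}_{\beta_k g}(Ax_k)\big)$; the oracle returns $\tilde s_k\in\mathcal{X}$ such that $$\langle v_k,\tilde s_k-x_k\rangle\le\delta\,\langle v_k,s_k-x_k\rangle,$$ where $s_k\in\arg\min_{x\in\mathcal{X}}\langle v_k,x\rangle$ is an exact solution; set $x_{k+1}=x_k+\eta_k(\tilde s_k-x_k)$. *)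

(* Defs.v *)
(* MathComp-Analysis, over an abstract realType. *)
From HB Require Import structures.
From mathcomp Require Import all_boot all_order all_algebra.
From mathcomp Require Import all_classical all_reals all_analysis.

Set Implicit Arguments.
Unset Strict Implicit.
Unset Printing Implicit Defensive.

Import Order.TTheory GRing.Theory Num.Theory.
Import numFieldNormedType.Exports.

Local Open Scope classical_set_scope.
Local Open Scope ring_scope.

Definition dot (R : realType) (n : nat) (u v : 'cV[R]_n) : R :=
  \sum_(i < n) u i ord0 * v i ord0.

(* The norm `|u| that the library puts on matrices is the sup norm; it induces
   the same topology as enorm. *)
Definition enorm (R : realType) (n : nat) (u : 'cV[R]_n) : R :=
  Num.sqrt (dot u u).

Definition spectral_norm (R : realType) (d n : nat) (A : 'M[R]_(d, n)) : R :=
  sup [set enorm (A *m x) | x in [set x : 'cV[R]_n | enorm x <= 1]].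

(* For X nonempty and compact this supremum is attained. *)
Definition diameter (R : realType) (n : nat) (X : set 'cV[R]_n) : R :=
  sup [set enorm (x - x') | x in X & x' in X].

Definition argmin (R : realType) (T : Type) (X : set T) (phi : T -> \bar R) :
    set T :=
  [set x | X x /\ forall y, X y -> (phi x <= phi y)%E].

(* "Closed" (closed epigraph) is lower semicontinuity. *)
Definition proper_closed_convex (R : realType) (n : nat)
    (phi : 'cV[R]_n -> \bar R) : Prop :=
  [/\ (forall x, phi x != -oo%E) /\ (exists x, phi x != +oo%E),
      lower_semicontinuous phi
    & forall (x y : 'cV[R]_n) (t : R), 0 < t -> t < 1 ->
        (phi (t *: x + (1 - t) *: y)%R <=
           t%:E * phi x + (1 - t)%:E * phi y)%E].

(* fine sends both infinities to 0, hence the finiteness near x. *)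
Definition differentiable_at (R : realType) (n : nat)
    (f : 'cV[R]_n -> \bar R) (x : 'cV[R]_n) : Prop :=
  (\forall y \near x, f y \is a fin_num) /\
  differentiable (fine \o f : 'cV[R]_n -> R^o) x.

Definition grad (R : realType) (n : nat) (f : 'cV[R]_n -> \bar R)
    (x : 'cV[R]_n) : 'cV[R]_n :=
  \col_(i < n) 'd (fine \o f : 'cV[R]_n -> R^o) x (delta_mx i ord0).

Definition smooth_on (R : realType) (n : nat) (X : set 'cV[R]_n)
    (f : 'cV[R]_n -> \bar R) (Lf : R) : Prop :=
  (forall x, X x -> differentiable_at f x) /\
  (forall x x', X x -> X x' ->
     enorm (grad f x - grad f x') <= Lf * enorm (x - x')).

Definition lipschitz_fun (R : realType) (d : nat) (g : 'cV[R]_d -> \bar R)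
    (Lg : R) : Prop :=
  forall z z' : 'cV[R]_d, (`|g z - g z'| <= (Lg * enorm (z - z')%R)%:E)%E.

(* When phi is proper, closed and convex the argmin is a singleton; the default
   value 0 is irrelevant then. *)
Definition prox (R : realType) (d : nat) (phi : 'cV[R]_d -> \bar R)
    (v : 'cV[R]_d) : 'cV[R]_d :=
  xget 0 (argmin setT
    (fun x => (phi x + (2^-1 * enorm (x - v)%R ^+ 2)%:E)%E)).

Definition objective (R : realType) (n d : nat) (f : 'cV[R]_n -> \bar R)
    (g : 'cV[R]_d -> \bar R) (A : 'M[R]_(d, n)) (x : 'cV[R]_n) : \bar R :=
  (f x + g (A *m x))%E.

Definition ccg_eta (R : realType) (delta : R) (k : nat) : R :=
  2 / (delta * (k%:R - 1) + 2).

Definition ccg_beta (R : realType) (delta beta0 : R) (k : nat) : R :=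
  beta0 / Num.sqrt (delta * k%:R + 1).

(* The vector v_k, for the smoothing parameter b and the iterate x. *)
Definition ccg_dir (R : realType) (n d : nat) (f : 'cV[R]_n -> \bar R)
    (g : 'cV[R]_d -> \bar R) (A : 'M[R]_(d, n)) (b : R) (x : 'cV[R]_n) :
    'cV[R]_n :=
  b *: grad f x + A^T *m (A *m x - prox (fun z => (b%:E * g z)%E) (A *m x)).

(* Sequences are indexed from 1; their values at index 0 are irrelevant.
   s k is an exact solution of the linear subproblem, st k the output of the
   oracle with multiplicative error delta. *)
Definition ccg_mult (R : realType) (n d : nat) (X : set 'cV[R]_n)
    (f : 'cV[R]_n -> \bar R) (g : 'cV[R]_d -> \bar R) (A : 'M[R]_(d, n))
    (delta beta0 : R) (x s st : nat -> 'cV[R]_n) : Prop :=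
  X (x 1%N) /\
  forall k : nat, (1 <= k)%N ->
    let v := ccg_dir f g A (ccg_beta delta beta0 k) (x k) in
    [/\ argmin X (fun y => (dot v y)%:E) (s k),
        X (st k),
        dot v (st k - x k) <= delta * dot v (s k - x k)
      & x k.+1 = x k + ccg_eta delta k *: (st k - x k)].

(* Main.v *)
Require Import Defs.
From HB Require Import structures.
From mathcomp Require Import all_boot all_order all_algebra.
From mathcomp Require Import all_classical all_reals all_analysis.
From mathcomp Require Import ring lra.

Set Implicit Arguments.
Unset Strict Implicit.
Unset Printing Implicit Defensive.

Import Order.TTheory GRing.Theory Num.Theory.
Import numFieldNormedType.Exports.

Local Open Scope classical_set_scope.
Local Open Scope ring_scope.

(** The algorithm is a Frank-Wolfe method applied to the smoothed objectives
    [F_b x = f x + g_b (A x)], where [g_b] is the Moreau envelope of [g] with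
    parameter [b]: the vector [v_k] of the run is [beta_k] times the gradient
    of [F_(beta_k)] at [x_k].  Let [h_k] be the gap
    [F_(beta_k) (x_k) - F xstar] ([smoothed_gap]).  Since
    [0 <= g - g_b <= b * Lg ^+ 2 / 2] ([envelope_le], [le_envelope]), it is
    enough to bound [h_k]; the second inequality accounts for the last term of
    the bound.

    One iteration ([ccg_step]) combines four facts: the descent lemma for [f],
    an upper bound for the envelope with the next, smaller parameter at the
    next point ([envelope_step]), the multiplicative oracle inequality, and two
    lower bounds at [xstar], the gradient inequality for [f] and
    [envelope_subgradient] for [g].  The last one is better than the mere
    convexity of [g_b] by [|A x - p|^2 / (2 b)], where [p] is the proximal
    point of [A x], and this surplus pays for the decrease of the smoothing
    parameter because the steps are large enough ([sqrt_increment_le]).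
    The outcome, with [q = delta * (k - 1) + 2], [m = delta * k + 1] and
    [P = D ^+ 2 * |A| ^+ 2 / beta0], is the recursion of [smoothed_gap_step]:

      [h_(k+1) <= (1 - 2 delta / q) h_k
         + 2 / q^2 * (D^2 Lf + P * (2 sqrt (m + delta) - sqrt m))].

    By induction it gives [h_k <= 2 / delta * (C / q + P / sqrt m)] with
    [C = D ^+ 2 * Lf + delta * E] ([rate_step], [smoothed_gap_rate]).  The
    smooth part is measured by [1 / q] and not by the larger [1 / m] of the
    final bound, because the recursion need not preserve [1 / m] when [delta] is
    small and [k = 1].

    The parameter is changed together with the point, from [F_(beta_k) (x_k)]
    to [F_(beta_(k+1)) (x_(k+1))].  Bounding [F_(beta_k) (x_(k+1))] instead
    would leave the error [beta_(k-1) * Lg ^+ 2 / 2] at [x_k], which exceeds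
    the announced [beta_k * Lg ^+ 2 / 2].

    For the second assertion, the part of the bound that depends on [b] is
    [1 / sqrt m] times a function of [b] alone, minimal at
    [b = 2 D |A| / (sqrt delta * Lg)] by completing a square. *)

(** * Euclidean geometry of column vectors *)

Section Euclidean.
Context {R : realType}.

Lemma dotC n (u v : 'cV[R]_n) : dot u v = dot v u.
Proof. by apply: eq_bigr => i _; rewrite mulrC. Qed.

Lemma dotDl n (u v w : 'cV[R]_n) : dot (u + v) w = dot u w + dot v w.
Proof. by rewrite -big_split; apply: eq_bigr => i _; rewrite mxE mulrDl. Qed.

Lemma dotZl n a (u w : 'cV[R]_n) : dot (a *: u) w = a * dot u w.
Proof. by rewrite /dot mulr_sumr; apply: eq_bigr => i _; rewrite mxE mulrA. Qed.

Lemma dotDr n (u v w : 'cV[R]_n) : dot w (u + v) = dot w u + dot w v.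
Proof. by rewrite dotC dotDl !(dotC w). Qed.

Lemma dotZr n a (u w : 'cV[R]_n) : dot w (a *: u) = a * dot w u.
Proof. by rewrite dotC dotZl dotC. Qed.

Lemma dotNl n (u w : 'cV[R]_n) : dot (- u) w = - dot u w.
Proof. by rewrite -scaleN1r dotZl mulN1r. Qed.

Lemma dotNr n (u w : 'cV[R]_n) : dot w (- u) = - dot w u.
Proof. by rewrite dotC dotNl dotC. Qed.

Lemma dotBl n (u v w : 'cV[R]_n) : dot (u - v) w = dot u w - dot v w.
Proof. by rewrite dotDl dotNl. Qed.

Lemma dotBr n (u v w : 'cV[R]_n) : dot w (u - v) = dot w u - dot w v.
Proof. by rewrite dotDr dotNr. Qed.

Lemma dot_ge0 n (u : 'cV[R]_n) : 0 <= dot u u.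
Proof. by apply: sumr_ge0 => i _; rewrite -expr2 sqr_ge0. Qed.

Lemma enorm_ge0 n (u : 'cV[R]_n) : 0 <= enorm u.
Proof. exact: sqrtr_ge0. Qed.

Lemma enorm_sqr n (u : 'cV[R]_n) : enorm u ^+ 2 = dot u u.
Proof. by rewrite sqr_sqrtr ?dot_ge0. Qed.

Lemma enormZ n a (u : 'cV[R]_n) : enorm (a *: u) = `|a| * enorm u.
Proof.
by rewrite /enorm dotZl dotZr mulrA -expr2 sqrtrM ?sqr_ge0// sqrtr_sqr.
Qed.

Lemma enormB n (u v : 'cV[R]_n) : enorm (u - v) = enorm (v - u).
Proof. by rewrite -opprB -scaleN1r enormZ normrN1 mul1r. Qed.

Lemma dot_trmx m n (A : 'M[R]_(m, n)) u v : dot (A^T *m u) v = dot u (A *m v).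
Proof.
have dotE k (a b : 'cV[R]_k) : dot a b = (a^T *m b) ord0 ord0.
  by rewrite mxE; apply: eq_bigr => i _; rewrite mxE.
by rewrite !dotE trmx_mul trmxK mulmxA.
Qed.

Lemma coord_le_enorm n (u : 'cV[R]_n) i : `|u i ord0| <= enorm u.
Proof.
rewrite -sqrtr_sqr ler_wsqrtr// /dot (bigD1 i)//= -expr2 lerDl.
by apply: sumr_ge0 => j _; rewrite -expr2 sqr_ge0.
Qed.

Lemma enorm_eq0 n (u : 'cV[R]_n) : enorm u = 0 -> u = 0.
Proof.
move=> u0; apply/matrixP => i j; rewrite mxE (ord1 j); apply/eqP.
by rewrite -normr_le0 -u0 coord_le_enorm.
Qed.

Lemma dot0l n (u : 'cV[R]_n) : dot 0 u = 0.
Proof. by rewrite -(scale0r 0) dotZl mul0r. Qed.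

Lemma enorm0 n : enorm (0 : 'cV[R]_n) = 0.
Proof. by rewrite /enorm dot0l sqrtr0. Qed.

Lemma cauchy_schwarz n (u v : 'cV[R]_n) : dot u v <= enorm u * enorm v.
Proof.
have [/enorm_eq0 ->|u0] := eqVneq (enorm u) 0.
  by rewrite dot0l enorm0 mul0r.
have [/enorm_eq0 ->|v0] := eqVneq (enorm v) 0.
  by rewrite dotC dot0l enorm0 mulr0.
have up : 0 < enorm u by rewrite lt_def u0 enorm_ge0.
have vp : 0 < enorm v by rewrite lt_def v0 enorm_ge0.
(* This square is [2 |u| |v| (|u| |v| - dot u v)]. *)
have := dot_ge0 (enorm v *: u - enorm u *: v).
rewrite !(dotBl, dotBr, dotZl, dotZr) -!enorm_sqr (dotC v u) => h.
rewrite -subr_ge0 -(pmulr_rge0 _ (mulr_gt0 up vp)).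
nra.
Qed.

(** The crude factor [n] only serves to show that the sets whose suprema define
    the diameter and the spectral norm are bounded. *)
Lemma enorm_coord_le n (u : 'cV[R]_n) (M : R) :
  (forall i, `|u i ord0| <= M) -> enorm u <= Num.sqrt (n%:R * M ^+ 2).
Proof.
move=> uM; rewrite ler_wsqrtr// -[n in n%:R]card_ord -sum1_card natr_sum.
rewrite mulr_suml; apply: ler_sum => i _.
rewrite -expr2 mul1r -real_normK ?num_real// lerXn2r// nnegrE//.
exact: le_trans (uM i).
Qed.

Lemma le_diameter n (X : set 'cV[R]_n) x y :
  compact X -> X x -> X y -> enorm (x - y) <= diameter X.
Proof.
move=> /compact_bounded [M [_ XM]] Xx Xy.
apply: ub_le_sup; last by exists x => //; exists y.
exists (Num.sqrt (n%:R * ((M + 1) + (M + 1)) ^+ 2)) => _ [a Xa [b Xb <-]].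
apply: enorm_coord_le => i; rewrite !mxE (le_trans (ler_normB _ _))//.
have bd (c : 'cV[R]_n) : X c -> `|c i ord0| <= M + 1.
  move=> Xc; have := XM (M + 1); rewrite ltrDl ltr01 => /(_ isT _ Xc).
  apply: le_trans; rewrite [leRHS]/Num.norm /= mx_normrE.
  by apply: (le_bigmax _ (fun ij => `|c ij.1 ij.2|) (i, ord0)).
by rewrite lerD ?bd.
Qed.

Lemma enorm_mulmx_le m n (A : 'M[R]_(m, n)) x :
  enorm (A *m x) <= spectral_norm A * enorm x.
Proof.
have ub y : enorm y <= 1 -> enorm (A *m y) <= spectral_norm A.
  move=> y1; apply: ub_le_sup; last by exists y.
  exists (Num.sqrt (m%:R * (\sum_(i < m) \sum_(j < n) `|A i j|) ^+ 2)).
  move=> _ [z z1 <-].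
  apply: enorm_coord_le => i; rewrite mxE (le_trans (ler_norm_sum _ _ _))//.
  apply: (@le_trans _ _ (\sum_(j < n) `|A i j|)).
    apply: ler_sum => j _; rewrite normrM ler_piMr//.
    exact: le_trans (coord_le_enorm _ _) z1.
  rewrite [leRHS](bigD1 i)//= lerDl; apply: sumr_ge0 => k _.
  by apply: sumr_ge0.
have [/enorm_eq0 ->|x0] := eqVneq (enorm x) 0.
  by rewrite mulmx0 !enorm0 mulr0.
have xp : 0 < enorm x by rewrite lt_def x0 enorm_ge0.
have := ub ((enorm x)^-1 *: x).
rewrite -scalemxAr !enormZ ger0_norm ?invr_ge0 ?enorm_ge0// mulVf//.
move=> /(_ (lexx _)).
by rewrite mulrC ler_pdivrMr.
Qed.

Lemma enorm_mulmx_sqr_le m n (A : 'M[R]_(m, n)) x :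
  enorm (A *m x) ^+ 2 <= spectral_norm A ^+ 2 * enorm x ^+ 2.
Proof.
have h := enorm_mulmx_le A x; rewrite -exprMn lerXn2r// nnegrE ?enorm_ge0//.
exact: le_trans (enorm_ge0 _) h.
Qed.

End Euclidean.

(** * Proximal points and the Moreau envelope *)

(** The minimality that defines [prox (b * g) z], for a real-valued [g]. *)
Definition is_prox (R : realType) (d : nat) (g : 'cV[R]_d -> R) (b : R)
    (z p : 'cV[R]_d) :=
  forall u, b * g p + 2^-1 * enorm (p - z) ^+ 2
    <= b * g u + 2^-1 * enorm (u - z) ^+ 2.

Section Prox.
Context {R : realType} {d : nat}.
Variables (g : 'cV[R]_d -> R) (L : R).
Hypothesis gL : forall z z', `|g z - g z'| <= L * enorm (z - z').

Lemma continuous_enorm (z : 'cV[R]_d) :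
  continuous (fun v : 'rV[R]_d => enorm (v^T - z)).
Proof.
move=> v; apply: (@continuous_comp _ _ _ (fun v => dot (v^T - z) (v^T - z))
  Num.sqrt); last exact: sqrt_continuous.
rewrite /dot; move: v; apply: (@continuous_big _ _ _ _ xpredT _ _ _
  (fun i (v : 'rV[R]_d) => (v^T - z) i ord0 * (v^T - z) i ord0)) => [|i _ v].
  exact: add_continuous.
have c : continuous (fun v : 'rV[R]_d => (v^T - z) i ord0 : R).
  move=> w.
  under eq_fun do rewrite !mxE.
  apply: (@continuousB R R _ (fun v : 'rV[R]_d => v ord0 i) (fun=> z i ord0)).
    exact: coord_continuous.
  exact: cst_continuous.
exact: (continuousM (c v) (c v)).
Qed.

(** The objective exceeds its value at [z] as soon as [|u - z| > 2 b L], so it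
    is enough to minimize it over a box, which is compact. *)
Lemma prox_exists (b : R) (z : 'cV[R]_d) : 0 < b ->
  exists p, is_prox g b z p.
Proof.
move=> b0.
(* [L] may be negative when [d = 0]. *)
pose L' := Num.max L 0.
have gL' u v : `|g u - g v| <= L' * enorm (u - v).
  by apply: le_trans (gL u v) _; rewrite ler_wpM2r ?enorm_ge0// le_max lexx.
have L0 : 0 <= L' by rewrite le_max lexx orbT.
pose h u := b * g u + 2^-1 * enorm (u - z) ^+ 2.
pose r := 2 * b * L'.
have r0 : 0 <= r by rewrite !mulr_ge0// ltW.
pose K := [set v : 'rV[R]_d |
  forall i, [set` `[z i ord0 - r, z i ord0 + r]] (v ord0 i)].
have gc : continuous (fun v : 'rV[R]_d => g v^T).
  move=> v; apply/(@cvgrPdist_le _ R^o 'rV[R]_d (nbhs v)) => e e0.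
  have /(_ v) : continuous (fun w : 'rV[R]_d => L' * enorm (w^T - v^T)).
    move=> w.
    apply: (@continuousM R _ (fun=> L')
      (fun w : 'rV[R]_d => enorm (w^T - v^T))).
      exact: cst_continuous.
    exact: continuous_enorm.
  rewrite /continuous_at subrr enorm0 mulr0.
  move/(@cvgrPdist_le _ R^o 'rV[R]_d (nbhs v)) => /(_ e e0) small.
  apply: (@filterS _ (nbhs v) _ _ _ _ small) => w.
  rewrite sub0r normrN => H; rewrite distrC.
  apply: le_trans (gL' _ _) _; apply: le_trans H; exact: ler_norm.
have Kz : K z^T by move=> i /=; rewrite mxE in_itv/= gerBl lerDl r0.
have [|||v _ vmin] := @compact_EVT_min _ R (fun v : 'rV[R]_d => h v^T) K.
- by exists z^T.
- apply: (@rV_compact R d (fun i => [set` `[z i ord0 - r, z i ord0 + r]])).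
  by move=> i; exact: segment_compact.
- apply: continuous_subspaceT => v.
  have cn := @continuous_enorm z v.
  apply: (@continuousD R R^o _ (fun v : 'rV[R]_d => b * g v^T)).
    apply: (@continuousM R _ (fun=> b) (fun v : 'rV[R]_d => g v^T)).
      exact: cst_continuous.
    exact: gc.
  apply: (@continuousM R _ (fun=> 2^-1)); first exact: cst_continuous.
  exact: (continuousM cn cn).
exists v^T => u; rewrite -/(h _) -/(h _).
have [uK|uK] := pselect (K u^T).
  by have := vmin u^T; rewrite trmxK; apply; apply/mem_set.
apply: (@le_trans _ _ (h z)).
  by have := vmin z^T; rewrite trmxK; apply; apply/mem_set.
(* Outside the box the quadratic term beats the decrease of [g]. *)
have ru : r < enorm (u - z).
  move/existsNP : uK => [i] /=; rewrite mxE in_itv/= => /negP.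
  rewrite -ler_distlC -ltNge => /lt_le_trans; apply.
  by apply: le_trans (coord_le_enorm _ i); rewrite !mxE distrC.
rewrite /h subrr enorm0 expr0n mulr0 addr0.
have := gL' z u; rewrite enormB => /(le_trans (ler_norm _)) H.
have := ler_wpM2l (ltW b0) H.
move: ru; rewrite /r; set E := enorm _ => ru H2.
have E0 : 0 <= E by exact: enorm_ge0.
have : 0 <= E * (E - 2 * b * L') by rewrite mulr_ge0// subr_ge0 ltW.
lra.
Qed.

End Prox.

Section Envelope.
Context {R : realType}.

Lemma le0_of_le_small (a c : R) :
  (forall t, 0 < t -> t < 1 -> a <= t * c) -> a <= 0.
Proof.
move=> ac; rewrite leNgt; apply/negP => a0.
have D0 : 0 < a + `|c| + 1 by have := normr_ge0 c; lra.
have := ac (a / (a + `|c| + 1)) (divr_gt0 a0 D0).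
rewrite ltr_pdivrMr// mul1r => h.
have {h} : a <= a / (a + `|c| + 1) * c by apply: h; have := normr_ge0 c; lra.
rewrite mulrAC ler_pdivlMr// ler_pM2l//.
by have := ler_norm c; lra.
Qed.

Context {d : nat}.
Variables (g : 'cV[R]_d -> R).

(** When [p] is the proximal point of [z] this is the value at [z] of the Moreau
    envelope of [g]; other points [p] give upper bounds for that value. *)
Definition envelope (b : R) (z p : 'cV[R]_d) :=
  g p + (2 * b)^-1 * enorm (z - p) ^+ 2.

Lemma envelope_le b z p u : 0 < b -> is_prox g b z p ->
  envelope b z p <= envelope b z u.
Proof.
move=> b0 /(_ u); rewrite /envelope (enormB z p) (enormB z u) => h.
have e x y : x + (2 * b)^-1 * y = b^-1 * (b * x + 2^-1 * y) by field; lra.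
by rewrite !e ler_pM2l ?invr_gt0.
Qed.

Hypothesis gconv : forall x y t, 0 < t -> t < 1 ->
  g (t *: x + (1 - t) *: y) <= t * g x + (1 - t) * g y.

(** Optimality of [p]: the vector [(z - p) / b] is a subgradient of [g] at [p].
    Comparing [p] with the point [p + t (u - p)] and dividing by [t] gives the
    inequality up to a term of order [t]. *)
Lemma prox_subgradient b z p u : 0 < b -> is_prox g b z p ->
  b * g p + dot (z - p) (u - p) <= b * g u.
Proof.
move=> b0 hp; rewrite -subr_le0.
apply: (@le0_of_le_small _ (2^-1 * dot (u - p) (u - p))) => t t0 t1.
have := hp (t *: u + (1 - t) *: p).
have -> : t *: u + (1 - t) *: p - z = t *: (u - p) - (z - p).
  by apply/matrixP => i j; rewrite !mxE; ring.
rewrite !enorm_sqr -(opprB z p) dotNl dotNr opprK.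
move: (z - p) (u - p) => w v.
rewrite dotBl !dotBr !(dotZl, dotZr) (dotC v w).
have := ler_wpM2l (ltW b0) (gconv u p t0 t1) => h1 h2.
rewrite -(ler_pM2l t0); nra.
Qed.

(** As [(z - p) / b] is the gradient of the envelope at [z], the left-hand side
    is a tangent to the envelope.  It stays below [g] itself by a margin, since
    the subgradient inequality for [g] is anchored at [p] rather than at [z]. *)
Lemma envelope_subgradient b z p u : 0 < b -> is_prox g b z p ->
  envelope b z p + b^-1 * dot (z - p) (u - z)
    <= g u - (2 * b)^-1 * dot (z - p) (z - p).
Proof.
move=> b0 hp; have := prox_subgradient u b0 hp.
have -> : u - p = (u - z) + (z - p) by rewrite subrKA.
rewrite /envelope enorm_sqr; move: (z - p) (u - z) => w v.
rewrite dotDr -[_ <= _ - _](ler_pM2l b0); move: (dot w w) (dot w v) => ww wu h.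
have -> : b * (g p + (2 * b)^-1 * ww + b^-1 * wu) = b * g p + 2^-1 * ww + wu.
  by field; lra.
have -> : b * (g u - (2 * b)^-1 * ww) = b * g u - 2^-1 * ww by field; lra.
lra.
Qed.

(** The old proximal point [p] is a competitor for the new envelope.  This gives
    [g p + |w + v|^2 / (2 b')] with [w = z - p] and [v = z' - z]; the inner
    product in it has the coefficient [1 / b'] instead of [1 / b], and the
    excess [(1 / b' - 1 / b) (w, v)] is absorbed by Young's inequality. *)
Lemma envelope_step b b' z z' p p' : 0 < b' -> b' <= b ->
  is_prox g b z p -> is_prox g b' z' p' ->
  envelope b' z' p' <= envelope b z p + b^-1 * dot (z - p) (z' - z)
    + (b'^-1 - b^-1) * dot (z - p) (z - p)
    + (b'^-1 - (2 * b)^-1) * dot (z' - z) (z' - z).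
Proof.
move=> b'0 b'b hp hp'; have b0 := lt_le_trans b'0 b'b.
apply: (le_trans (envelope_le p b'0 hp')).
rewrite /envelope !enorm_sqr.
have -> : z' - p = (z - p) + (z' - z) by rewrite [RHS]addrC subrKA.
move: (z - p) (z' - z) => w v; have := dot_ge0 (w - v).
rewrite dotBl !dotBr dotDl !dotDr (dotC v w).
move: (dot w w) (dot w v) (dot v v) => ww wd dd h.
have bb : 0 <= b'^-1 - b^-1 by rewrite subr_ge0 lef_pV2.
rewrite !invfM; move: bb; move: b^-1 b'^-1 => i i' bb.
have : 0 <= (i' - i) * (ww - wd - (wd - dd)) by rewrite mulr_ge0.
nra.
Qed.

(** [g z - g p <= L |z - p|], and [L w <= w^2 / (2 b) + b L^2 / 2]. *)
Lemma le_envelope b z p L : 0 < b ->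
  (forall u v, `|g u - g v| <= L * enorm (u - v)) ->
  g z <= envelope b z p + b * L ^+ 2 / 2.
Proof.
move=> b0 gL; have := le_trans (ler_norm _) (gL z p).
rewrite /envelope; set w := enorm _ => h.
have : 0 <= (w - b * L) ^+ 2 / (2 * b).
  by rewrite divr_ge0 ?sqr_ge0// mulr_ge0// ltW.
have -> : (w - b * L) ^+ 2 / (2 * b)
    = (2 * b)^-1 * w ^+ 2 - L * w + b * L ^+ 2 / 2.
  by field; lra.
lra.
Qed.

End Envelope.

(** * Scalar inequalities for the step sizes and smoothing parameters *)

Section Rates.
Context {R : realFieldType}.
Implicit Types delta q s r : R.

Lemma smooth_rate_step delta q : 0 < delta -> 2 <= q ->
  (1 - 2 * delta / q) / q + delta / q ^+ 2 <= (q + delta)^-1.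
Proof.
move=> d0 q2.
rewrite -subr_ge0.
have -> : (q + delta)^-1 - ((1 - 2 * delta / q) / q + delta / q ^+ 2)
  = delta ^+ 2 / (q ^+ 2 * (q + delta)) by field; rewrite !lt0r_neq0//; lra.
by rewrite divr_ge0 ?sqr_ge0// mulr_ge0 ?sqr_ge0//; lra.
Qed.

(** With [r^2 - s^2 = delta], the decrease [1 / s - 1 / r] is at most
    [delta / (2 s^3)], and [2 r - s <= r^2 / s].  What remains is a rational
    inequality in [q] and [delta], an equality at [q = 2], [delta = 1]. *)
Lemma nonsmooth_rate_step delta q s r :
  0 < delta -> delta <= 1 -> 2 <= q -> 0 < s -> 0 < r ->
  s ^+ 2 = q - 1 + delta -> r ^+ 2 = q - 1 + 2 * delta ->
  (1 - 2 * delta / q) / s + delta / q ^+ 2 * (2 * r - s) <= r^-1.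
Proof.
move=> d0 d1 q2 s0 r0 sE rE.
have q0 : 0 < q by lra.
have sr : s <= r.
  by rewrite -(ler_pXn2r (n := 2)) ?nnegrE ?ltW//; lra.
have h1 : s^-1 - r^-1 <= delta / (2 * s * s ^+ 2).
  have -> : s^-1 - r^-1 = delta / (r * s * (r + s)).
    have -> : delta = r ^+ 2 - s ^+ 2 by rewrite rE sE; lra.
    by field; rewrite !lt0r_neq0//; lra.
  rewrite ler_pM2l// lef_pV2 ?posrE ?mulr_gt0 ?exprn_gt0//; last by lra.
  nra.
have h2 : 2 * r - s <= r ^+ 2 / s.
  by rewrite ler_pdivlMr//; have := sqr_ge0 (r - s); lra.
have h3 : (2 * s ^+ 2)^-1 + r ^+ 2 / q ^+ 2 <= 2 / q.
  rewrite sE rE -subr_ge0.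
  have -> : 2 / q - ((2 * (q - 1 + delta))^-1 + (q - 1 + 2 * delta) / q ^+ 2)
    = (4 * q * (q - 1 + delta) - q ^+ 2
        - 2 * (q - 1 + delta) * (q - 1 + 2 * delta))
      / (2 * (q - 1 + delta) * q ^+ 2) by field; rewrite !lt0r_neq0//; lra.
  rewrite divr_ge0//; last by rewrite !mulr_ge0 ?sqr_ge0//; lra.
  nra.
have h4 : delta / q ^+ 2 * (2 * r - s) <= delta / q ^+ 2 * (r ^+ 2 / s).
  by rewrite ler_wpM2l// divr_ge0 ?sqr_ge0// ltW.
have h5 : delta / s * ((2 * s ^+ 2)^-1 + r ^+ 2 / q ^+ 2)
    <= delta / s * (2 / q).
  by rewrite ler_wpM2l// divr_ge0// ltW.
have e1 : delta / s * (2 / q) = s^-1 - (1 - 2 * delta / q) / s.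
  by field; rewrite !lt0r_neq0//; lra.
have e2 : delta / s * ((2 * s ^+ 2)^-1 + r ^+ 2 / q ^+ 2) =
   delta / (2 * s * s ^+ 2) + delta / q ^+ 2 * (r ^+ 2 / s).
  by field; rewrite !lt0r_neq0//; lra.
lra.
Qed.

(** For [beta_k = beta0 / s] and [beta_(k+1) = beta0 / r] this bounds the
    increase of [1 / beta] by [delta * eta / (2 beta_k)], where [eta = 2 / q] is
    the step size; it is what makes the surplus of [envelope_subgradient]
    sufficient. *)
Lemma sqrt_increment_le delta q s r :
  0 < delta -> delta <= 1 -> 2 <= q -> 0 < s -> 0 < r ->
  s ^+ 2 = q - 1 + delta -> r ^+ 2 = q - 1 + 2 * delta ->
  r - s <= s * delta / q.
Proof.
move=> d0 d1 q2 s0 r0 sE rE.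
rewrite ler_pdivlMr; last by lra.
have h : (r - s) * (2 * s) <= delta.
  have h := sqr_ge0 (r - s).
  have -> : delta = r ^+ 2 - s ^+ 2 by rewrite rE sE; lra.
  lra.
have h2 : q <= 2 * s ^+ 2 by rewrite sE; lra.
have rs : 0 <= r - s.
  by rewrite subr_ge0 -(ler_pXn2r (n := 2)) ?nnegrE ?ltW//; lra.
have h3 := ler_wpM2l rs h2; have h4 := ler_wpM2r (ltW s0) h; lra.
Qed.

(** [G] is the coefficient [D ^+ 2 * Lf] of the recursion.  Replacing it by the
    larger [C] makes the recursion a combination, with the coefficients [C] and
    [P], of [smooth_rate_step] and [nonsmooth_rate_step]. *)
Lemma rate_step delta q s r G C P h h' :
  0 < delta -> delta <= 1 -> 2 <= q -> 0 < s -> 0 < r ->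
  s ^+ 2 = q - 1 + delta -> r ^+ 2 = q - 1 + 2 * delta ->
  0 <= C -> G <= C -> 0 <= P ->
  h <= 2 / delta * (C / q + P / s) ->
  h' <= (1 - 2 * delta / q) * h + 2 / q ^+ 2 * (G + P * (2 * r - s)) ->
  h' <= 2 / delta * (C / (q + delta) + P / r).
Proof.
move=> d0 d1 q2 s0 r0 sE rE C0 GC P0 hh hh'.
have q0 : 0 < q by lra.
have c0 : 0 <= 1 - 2 * delta / q by rewrite subr_ge0 ler_pdivrMr//; lra.
have h1 := ler_wpM2l C0 (smooth_rate_step d0 q2).
have h2 := ler_wpM2l P0 (nonsmooth_rate_step d0 d1 q2 s0 r0 sE rE).
have h3 := ler_wpM2l c0 hh.
have p0 : 0 <= 2 / q ^+ 2 by rewrite divr_ge0 ?sqr_ge0.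
have h4 := ler_wpM2l p0 GC.
have h5 := ler_wpM2l (divr_ge0 (ler0n R 2) (ltW d0)) (lerD h1 h2).
apply: (le_trans hh'); apply: le_trans h5.
apply: (@le_trans _ _ ((1 - 2 * delta / q) * (2 / delta * (C / q + P / s))
   + 2 / q ^+ 2 * (C + P * (2 * r - s)))); first by lra.
rewrite le_eqVlt; apply/orP; left; apply/eqP.
by field; rewrite !lt0r_neq0.
Qed.

End Rates.

Section OptimalSmoothing.
Context {R : realType}.

Lemma optimal_smoothing (delta a Lg : R) : 0 < delta -> 0 < a -> 0 < Lg ->
  exists2 b : R, 0 < b & forall b' : R, 0 < b' ->
    2 / delta * (a ^+ 2 / b) + b * Lg ^+ 2 / 2
      <= 2 / delta * (a ^+ 2 / b') + b' * Lg ^+ 2 / 2.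
Proof.
move=> d0 a0 L0; pose t := Num.sqrt delta.
have t0 : 0 < t by rewrite sqrtr_gt0.
have -> : delta = t ^+ 2 by rewrite sqr_sqrtr// ltW.
exists (2 * a / (t * Lg)) => [|b' b'0]; first by rewrite divr_gt0 ?mulr_gt0.
rewrite -subr_ge0.
have -> : 2 / t ^+ 2 * (a ^+ 2 / b') + b' * Lg ^+ 2 / 2 -
    (2 / t ^+ 2 * (a ^+ 2 / (2 * a / (t * Lg)))
     + 2 * a / (t * Lg) * Lg ^+ 2 / 2)
  = (2 * a / t - b' * Lg) ^+ 2 / (2 * b').
  by field; rewrite !lt0r_neq0.
by rewrite divr_ge0 ?sqr_ge0// mulr_ge0// ltW.
Qed.

End OptimalSmoothing.

(** * Smooth convex functions *)

Section Smooth.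
Context {R : realType} {n : nat}.
Implicit Types (f : 'cV[R]_n -> \bar R) (x v : 'cV[R]_n).

Local Notation real f := (fine \o f : 'cV[R]_n -> R^o).

Lemma dot_grad f x v : dot (grad f x) v = 'd (real f) x v.
Proof.
rewrite [v in RHS]matrix_sum_delta linear_sum; apply: eq_bigr => i _.
by rewrite big_ord1 linearZ mxE mulrC.
Qed.

(** The difference quotients along the line are literally those of the
    directional derivative of [f] at the point. *)
Lemma is_derive_line f x v (t : R) : differentiable (real f) (x + t *: v) ->
  is_derive t 1 (fun u : R => fine (f (x + u *: v)) : R^o)
    (dot (grad f (x + t *: v)) v).
Proof.
move=> df.
have E : (fun h : R => h^-1 *:
      (((fun u : R => fine (f (x + u *: v)) : R^o) \o shift t) (h *: 1)
       - fine (f (x + t *: v)))) =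
    (fun h : R => h^-1 *: ((real f \o shift (x + t *: v)) (h *: v)
       - real f (x + t *: v))).
  apply/funext => h; congr (_ *: (fine (f _) - _)).
  by rewrite /= /shift [h *: 1]mulr1 scalerDl addrCA.
split.
  by rewrite /derivable E; exact: diff_derivable.
by rewrite /derive E -/(derive (real f) _ v) deriveE// dot_grad.
Qed.

(** By convexity on the segment the difference quotients from [x] towards [y]
    are at most [f y - f x]; let the step tend to [0] from the right. *)
Lemma gradient_inequality f x y :
  differentiable (real f) x ->
  (forall t, 0 < t -> t < 1 ->
    fine (f (x + t *: (y - x))) <= (1 - t) * fine (f x) + t * fine (f y)) ->
  fine (f x) + dot (grad f x) (y - x) <= fine (f y).
Proof.
move=> df fconv; rewrite -lerBrDl dot_grad -deriveE//.
have /cvg_dnbhs_at_right := diff_derivable (v := y - x) df.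
move/(@cvgr_to_le _ _ _ _ _ _ (fine (f y) - fine (f x))); apply.
near=> h.
have h0 : 0 < h by near: h; exact: nbhs_right_gt.
have h1 : h < 1 by near: h; exact: nbhs_right_lt.
have := fconv h h0 h1.
rewrite /= /shift (addrC x) => H.
by rewrite ler_pdivrMl//; lra.
Unshelve. all: by end_near. Qed.

(** Mean value theorem for
    [t |-> f (x + t v) - t (grad f x, v) - L t^2 |v|^2 / 2] with [v = y - x],
    whose derivative is nonpositive on the unit interval since the gradient is
    [L]-Lipschitz along the segment. *)
Lemma descent_lemma (X : set 'cV[R]_n) f (L : R) x y :
  (forall t, 0 <= t -> t <= 1 -> X (x + t *: (y - x))) ->
  smooth_on X f L ->
  fine (f y) <= fine (f x) + dot (grad f x) (y - x)
    + L / 2 * enorm (y - x) ^+ 2.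
Proof.
move=> Xseg [df gL]; set v := y - x.
have Xx : X x by have := Xseg 0 (lexx _) ler01; rewrite scale0r addr0.
pose c := dot (grad f x) v.
pose e := enorm v ^+ 2.
pose phi := fun u : R => fine (f (x + u *: v)) : R^o.
pose psi := phi -
  (c *: (id : R -> R^o) + (L / 2 * e) *: ((id : R -> R^o) ^+ 2)).
have dpsi (t : R) : 0 <= t -> t <= 1 ->
    is_derive t 1 psi (dot (grad f (x + t *: v)) v - (c + L * e * t)).
  move=> t0 t1.
  have D := is_derive_line (df _ (Xseg t t0 t1)).2.
  have Did := @is_derive_id R R^o t 1.
  apply: (is_derive_eq (is_deriveB D (is_deriveD (is_deriveZ c Did)
    (is_deriveZ (L / 2 * e) (is_deriveX 2 Did))))).
  by rewrite /= /GRing.scale/= !mulr1; field.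
have [||t t01 E] := @MVT R psi
  (fun t => dot (grad f (x + t *: v)) v - (c + L * e * t)) 0 1 ltr01.
- by move=> t; rewrite in_itv/= => /andP[/ltW t0 /ltW t1]; exact: dpsi.
- apply: derivable_within_continuous => t; rewrite in_itv/= => /andP[t0 t1].
  by have [] := dpsi t t0 t1.
have /andP[/ltW t0 /ltW t1] : (0 < t) && (t < 1) by rewrite in_itv/= in t01.
have Xt := Xseg t t0 t1.
have h : dot (grad f (x + t *: v)) v - c <= L * e * t.
  rewrite -dotBl (le_trans (cauchy_schwarz _ _))//.
  have := ler_wpM2r (enorm_ge0 v) (gL _ _ Xt Xx).
  rewrite [x + _]addrC addrK enormZ (ger0_norm t0) => /le_trans; apply.
  by rewrite le_eqVlt; apply/orP; left; apply/eqP; rewrite /e; ring.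
have : psi 1 - psi 0 <= 0 by rewrite E subr0 mulr1; lra.
have psiE u : psi u =
  fine (f (x + u *: v)) - (c * u + L / 2 * e * u ^+ 2) by [].
rewrite !psiE scale0r addr0 scale1r subrKC.
by rewrite -/c -/e; lra.
Qed.

End Smooth.

(** * One step of the method *)

Section Step.
Context {R : realType} {n d : nat}.
Variables (X : set 'cV[R]_n) (f : 'cV[R]_n -> \bar R) (g : 'cV[R]_d -> \bar R).

Lemma convex_set_segment x y (t : R) : convex_set X -> X x -> X y ->
  0 <= t -> t <= 1 -> X (x + t *: (y - x)).
Proof.
move=> cX Xx Xy t0 t1.
have := cX y x (Itv01 t0 t1) (mem_set Xy) (mem_set Xx).
rewrite /conv/= => /set_mem.
by congr X; apply/matrixP => i j; rewrite !mxE/= /unstable.onem; ring.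
Qed.

(** An infinite value would be at infinite distance from a finite one. *)
Lemma lipschitz_fin_num L z : proper_closed_convex g -> lipschitz_fun g L ->
  g z \is a fin_num.
Proof.
move=> [[gNy [z0 gz0]] _ _] gL.
have z0fin : g z0 \is a fin_num by rewrite fin_numE gNy gz0.
have := gL z z0; rewrite -(fineK z0fin) fin_numE gNy /=.
by case: (g z).
Qed.

Lemma lipschitz_real L z z' : proper_closed_convex g -> lipschitz_fun g L ->
  `|fine (g z) - fine (g z')| <= L * enorm (z - z').
Proof.
move=> gpcc gL; have := gL z z'.
rewrite -(fineK (lipschitz_fin_num z gpcc gL)).
by rewrite -(fineK (lipschitz_fin_num z' gpcc gL)).
Qed.

Lemma fine_convex m (h : 'cV[R]_m -> \bar R) x y t :
  proper_closed_convex h ->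
  h x \is a fin_num -> h y \is a fin_num ->
  h (t *: x + (1 - t) *: y) \is a fin_num -> 0 < t -> t < 1 ->
  fine (h (t *: x + (1 - t) *: y)) <= t * fine (h x) + (1 - t) * fine (h y).
Proof.
move=> [_ _ hc] hx hy hxy t0 t1; have := hc x y t t0 t1.
by rewrite -{1}(fineK hx) -{1}(fineK hy) -{1}(fineK hxy).
Qed.

Lemma prox_is_prox L b z : proper_closed_convex g -> lipschitz_fun g L ->
  0 < b -> is_prox (fine \o g) b z (prox (fun u => (b%:E * g u)%E) z).
Proof.
move=> gpcc gL b0 u.
have [p hp] := prox_exists (fun z z' => lipschitz_real z z' gpcc gL) z b0.
have gE w : g w = (fine (g w))%:E.
  by rewrite fineK// (lipschitz_fin_num _ gpcc gL).
rewrite /prox.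
set P := argmin _ _; have : P (xget 0 P).
  apply: (xgetPex 0); exists p; split => // y _.
  by rewrite (gE p) (gE y) lee_fin.
by move=> [_ /(_ u I)]; rewrite (gE (xget 0 P)) (gE u) lee_fin.
Qed.

Lemma smooth_fin_num Lf x : smooth_on X f Lf -> X x -> f x \is a fin_num.
Proof. by move=> [df _] /df[] /nbhs_singleton. Qed.

Lemma smooth_gradient_inequality Lf x y : proper_closed_convex f ->
  smooth_on X f Lf -> convex_set X -> X x -> X y ->
  fine (f x) + dot (grad f x) (y - x) <= fine (f y).
Proof.
move=> fpcc fs cX Xx Xy.
apply: gradient_inequality => [|t t0 t1]; first exact: (fs.1 _ Xx).2.
have := convex_set_segment cX Xx Xy (ltW t0) (ltW t1).
have -> : x + t *: (y - x) = t *: y + (1 - t) *: x.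
  by apply/matrixP => i j; rewrite !mxE; ring.
move=> Xt; rewrite [leRHS]addrC.
by apply: fine_convex => //; exact: smooth_fin_num fs _.
Qed.

(** The core estimate, for arbitrary parameters [b' <= b] and step size.  The
    terms in [|w|^2] are [1 / b' - 1 / b] from the change of parameter and
    [- delta * eta / (2 b)] from the subgradient inequality at [xs]; the bound
    on [b'^-1 - b^-1] says that their sum is nonpositive. *)
Lemma ccg_step (A : 'M[R]_(d, n)) (Lf delta eta b b' : R) x st xs p p' :
  let w := A *m x - p in
  let gr := fine \o g in
  let x' := x + eta *: (st - x) in
  let Fs := fine (f xs) + gr (A *m xs) in
  convex_set X -> proper_closed_convex f -> smooth_on X f Lf ->
  (forall u v t, 0 < t -> t < 1 ->
    gr (t *: u + (1 - t) *: v) <= t * gr u + (1 - t) * gr v) ->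
  X x -> X st -> X xs -> 0 <= delta -> 0 <= eta -> eta <= 1 ->
  0 < b' -> b' <= b -> b'^-1 - b^-1 <= delta * eta / 2 * b^-1 ->
  is_prox gr b (A *m x) p -> is_prox gr b' (A *m x') p' ->
  dot (b *: grad f x + A^T *m w) (st - x)
    <= delta * dot (b *: grad f x + A^T *m w) (xs - x) ->
  fine (f x') + envelope gr b' (A *m x') p' - Fs
    <= (1 - delta * eta) * (fine (f x) + envelope gr b (A *m x) p - Fs)
       + eta ^+ 2 / 2 * (Lf * enorm (st - x) ^+ 2
            + (2 * b'^-1 - b^-1) * enorm (A *m (st - x)) ^+ 2).
Proof.
move=> w gr x' Fs cX fpcc fs gconv Xx Xst Xxs d0 e0 e1 b'0 b'b bb hp hp' ora.
have b0 := lt_le_trans b'0 b'b.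
have Xx' : X x' by exact: convex_set_segment.
have dx : x' - x = eta *: (st - x) by rewrite /x' [x + _]addrC addrK.
have dz : A *m x' - A *m x = eta *: (A *m (st - x)).
  by rewrite -mulmxBr dx -scalemxAr.
have := descent_lemma (fun t t0 t1 => convex_set_segment cX Xx Xx' t0 t1) fs.
rewrite dx dotZr enormZ (ger0_norm e0) => Hf.
have := envelope_step b'0 b'b hp hp'; rewrite dz -/w !(dotZl, dotZr) => Hg.
have Lf1 := smooth_gradient_inequality fpcc fs cX Xx Xxs.
have := envelope_subgradient gconv (A *m xs) b0 hp; rewrite -/w -mulmxBr => Lg1.
move: ora; rewrite !dotDl !dotZl !dot_trmx => ora.
have ww0 := dot_ge0 w.
rewrite !enorm_sqr in Hf *.
have ora' := ler_wpM2l (mulr_ge0 e0 (ltW (etrans (invr_gt0 b) b0))) ora.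
have low := ler_wpM2l (mulr_ge0 d0 e0) (lerD Lf1 Lg1).
have small := ler_wpM2r ww0 bb.
move: Hf Hg ora' low small; rewrite exprMn enorm_sqr /Fs.
rewrite (_ : (2 * b)^-1 = b^-1 / 2); last by rewrite invfM mulrC.
move: (dot w w) (dot w (A *m (st - x))) (dot w (A *m (xs - x))) => ww wst wxs.
move: (dot (A *m _) _) (dot (st - x) _) (dot (grad f x) (st - x))
  (dot (grad f x) (xs - x)) => aa ee gst gxs.
move: (envelope gr b' _ _) (envelope gr b _ _) (gr _) => v' v gs.
move: (fine (f x')) (fine (f x)) (fine (f xs)) => fx' fx fxs.
rewrite (_ : eta * b^-1 * (b * gst + wst) = eta * gst + b^-1 * (eta * wst));
  last by field; lra.
rewrite (_ : eta * b^-1 * (delta * (b * gxs + wxs)) =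
   delta * eta * (gxs + b^-1 * wxs)); last by field; lra.
by move: (b^-1) b'^-1 => i i'; lra.
Qed.

(** If [Lf < 0], the Lipschitz condition forces all the distances in [X], and
    with them the diameter, to vanish. *)
Lemma diameter_smooth_bound Lf x y : compact X -> smooth_on X f Lf ->
  X x -> X y -> Lf * enorm (x - y) ^+ 2 <= diameter X ^+ 2 * Lf.
Proof.
move=> cX [_ gL] Xx Xy; rewrite mulrC.
have D0 a b : X a -> X b -> enorm (a - b) <= diameter X by exact: le_diameter.
have [L0|L0] := leP 0 Lf.
  rewrite ler_wpM2r// lerXn2r ?nnegrE ?enorm_ge0 ?D0//.
  exact: le_trans (enorm_ge0 _) (D0 _ _ Xx Xy).
have e0 a b : X a -> X b -> enorm (a - b) = 0.
  move=> Xa Xb; apply/eqP; rewrite eq_le enorm_ge0 andbT -(ler_nM2l L0) mulr0.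
  exact: le_trans (enorm_ge0 _) (gL _ _ Xa Xb).
suff -> : diameter X = 0 by rewrite e0// expr0n !mul0r.
apply/eqP; rewrite eq_le -{2}(e0 x x Xx Xx) D0// andbT.
apply: ge_sup; first by exists (enorm (x - x)); exists x => //; exists x.
by move=> _ [a Xa [b Xb <-]]; rewrite e0.
Qed.

End Step.

(** * The run of the algorithm *)

Section StepSizes.
Context {R : realType}.
Implicit Types (delta : R) (k : nat).

Lemma scale_natr_ge0 delta k : 0 < delta -> 0 <= delta * k%:R.
Proof. by move=> d0; rewrite mulr_ge0// ltW. Qed.

Lemma ccg_etaE delta k : ccg_eta delta k.+1 = 2 / (delta * k%:R + 2).
Proof. by rewrite /ccg_eta -[k.+1]addn1 natrD addrK. Qed.

Lemma ccg_eta_itv delta k : 0 < delta -> 0 <= ccg_eta delta k.+1 <= 1.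
Proof.
move=> d0; have h := scale_natr_ge0 k d0; rewrite ccg_etaE; apply/andP; split.
  by rewrite divr_ge0//; lra.
by rewrite ler_pdivrMr//; lra.
Qed.

Lemma ccg_sqrt_gt0 delta k : 0 < delta -> 0 < Num.sqrt (delta * k%:R + 1).
Proof. by move=> d0; rewrite sqrtr_gt0 ltr_wpDl// scale_natr_ge0. Qed.

Lemma ccg_beta_gt0 delta (beta0 : R) k :
  0 < delta -> 0 < beta0 -> 0 < ccg_beta delta beta0 k.
Proof. by move=> d0 b0; rewrite divr_gt0// ccg_sqrt_gt0. Qed.

Lemma ccg_betaV delta (beta0 : R) k :
  (ccg_beta delta beta0 k)^-1 = Num.sqrt (delta * k%:R + 1) / beta0.
Proof. by rewrite /ccg_beta invf_div. Qed.

End StepSizes.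

Section Convergence.
Context {R : realType} {n d : nat}.
Variables (X : set 'cV[R]_n) (f : 'cV[R]_n -> \bar R) (g : 'cV[R]_d -> \bar R).
Variables (A : 'M[R]_(d, n)) (Lf Lg delta beta0 : R) (xstar : 'cV[R]_n).
Variables (x s st : nat -> 'cV[R]_n).
Hypotheses (Xcompact : compact X) (Xconvex : convex_set X).
Hypotheses (fpcc : proper_closed_convex f) (fsmooth : smooth_on X f Lf).
Hypotheses (gpcc : proper_closed_convex g) (gLip : lipschitz_fun g Lg).
Hypothesis xstarP : argmin X (objective f g A) xstar.
Hypotheses (delta_gt0 : 0 < delta) (delta_le1 : delta <= 1).
Hypothesis beta0_gt0 : 0 < beta0.
Hypothesis run : ccg_mult X f g A delta beta0 x s st.

Local Notation beta k := (ccg_beta delta beta0 k).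
Local Notation gr := (fine \o g).
Local Notation D := (diameter X).
Local Notation root k := (Num.sqrt (delta * k%:R + 1)).
Local Notation E := (fine (objective f g A (x 1%N) - objective f g A xstar)%E).
Local Notation P := (D ^+ 2 * spectral_norm A ^+ 2 / beta0).

Let proxk k := prox (fun u => ((beta k)%:E * g u)%E) (A *m x k).

Let proxkP k : is_prox gr (beta k) (A *m x k) (proxk k).
Proof. exact: prox_is_prox gpcc gLip (ccg_beta_gt0 k delta_gt0 beta0_gt0). Qed.

Lemma objective_fin y : X y ->
  objective f g A y = (fine (f y) + gr (A *m y))%:E.
Proof.
move=> Xy; rewrite /objective EFinD !fineK//.
  exact: lipschitz_fin_num gpcc gLip.
exact: smooth_fin_num fsmooth Xy.
Qed.

Lemma iterate_in k : X (x k.+1).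
Proof.
elim: k => [|k IH]; first by case: run.
have [_ Xst _ ->] := run.2 k.+1 isT.
by have /andP[] := ccg_eta_itv k delta_gt0; exact: convex_set_segment.
Qed.

Lemma initial_gapE : E =
  fine (f (x 1%N)) + gr (A *m x 1%N) - (fine (f xstar) + gr (A *m xstar)).
Proof. by rewrite (objective_fin (iterate_in 0)) (objective_fin xstarP.1). Qed.

Lemma initial_gap_ge0 : 0 <= E.
Proof.
have := xstarP.2 _ (iterate_in 0); rewrite initial_gapE.
rewrite (objective_fin (iterate_in 0)) (objective_fin xstarP.1) lee_fin.
by rewrite subr_ge0.
Qed.

Let smooth_const_ge0 : 0 <= D ^+ 2 * Lf.
Proof.
have := diameter_smooth_bound Xcompact fsmooth xstarP.1 xstarP.1.
by rewrite subrr enorm0 expr0n mulr0.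
Qed.

Let nonsmooth_const_ge0 : 0 <= P.
Proof.
exact: divr_ge0 (mulr_ge0 (sqr_ge0 _) (sqr_ge0 _)) (ltW beta0_gt0).
Qed.

(** [F_(beta_k) (x_k) - F xstar] in real numbers; the smoothing parameter has
    the index of the iterate. *)
Definition smoothed_gap k :=
  fine (f (x k)) + envelope gr (beta k) (A *m x k) (proxk k)
  - (fine (f xstar) + gr (A *m xstar)).

(** [ccg_step] with the parameters of the run.  The exact solution [s k] of the
    linear subproblem enters through its comparison with [xstar]. *)
Lemma smoothed_gap_step k (q := delta * k%:R + 2) :
  smoothed_gap k.+2 <= (1 - 2 * delta / q) * smoothed_gap k.+1
    + 2 / q ^+ 2 * (D ^+ 2 * Lf + P * (2 * root k.+2 - root k.+1)).
Proof.
have [[_ smin] Xst ora xE] := run.2 k.+1 isT.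
have d1 := ltW delta_gt0.
have q2 : 2 <= q by rewrite lerDr scale_natr_ge0.
have q0 : q != 0 by rewrite lt0r_neq0// (lt_le_trans _ q2).
have r1 : 0 < root k.+1 by exact: ccg_sqrt_gt0.
have r2 : 0 < root k.+2 by exact: ccg_sqrt_gt0.
have sqr_root j : root j ^+ 2 = delta * j%:R + 1.
  by rewrite sqr_sqrtr// addr_ge0// scale_natr_ge0.
have sE : root k.+1 ^+ 2 = q - 1 + delta.
  by rewrite sqr_root /q -[k.+1]addn1 natrD; ring.
have rE : root k.+2 ^+ 2 = q - 1 + 2 * delta.
  by rewrite sqr_root /q -[k.+2]addn2 natrD; ring.
have etaE : ccg_eta delta k.+1 = 2 / q by exact: ccg_etaE.
have root_le : root k.+1 <= root k.+2.
  by rewrite ler_wsqrtr// lerD2r ler_wpM2l// ler_nat.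
have beta_le : beta k.+2 <= beta k.+1.
  by rewrite /ccg_beta ler_wpM2l ?(ltW beta0_gt0)// lef_pV2 ?posrE.
have betaV_le : (beta k.+2)^-1 - (beta k.+1)^-1
    <= delta * ccg_eta delta k.+1 / 2 * (beta k.+1)^-1.
  have h := sqrt_increment_le delta_gt0 delta_le1 q2 r1 r2 sE rE.
  rewrite !ccg_betaV -mulrBl mulrA ler_pM2r ?invr_gt0// (le_trans h)//.
  by rewrite le_eqVlt; apply/orP; left; apply/eqP; rewrite etaE; field.
have /andP[e0 e1] := ccg_eta_itv k delta_gt0.
have ora' : dot (ccg_dir f g A (beta k.+1) (x k.+1)) (st k.+1 - x k.+1)
    <= delta * dot (ccg_dir f g A (beta k.+1) (x k.+1)) (xstar - x k.+1).
  apply: (le_trans ora); rewrite ler_wpM2l// !dotBr lerD2r.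
  by have := smin _ xstarP.1; rewrite lee_fin.
have gconv u v t : 0 < t -> t < 1 ->
    gr (t *: u + (1 - t) *: v) <= t * gr u + (1 - t) * gr v.
  by apply: fine_convex; rewrite ?(lipschitz_fin_num _ gpcc gLip).
have hp := proxkP k.+2; rewrite xE in hp.
have step : smoothed_gap k.+2
    <= (1 - delta * ccg_eta delta k.+1) * smoothed_gap k.+1
      + ccg_eta delta k.+1 ^+ 2 / 2 * (Lf * enorm (st k.+1 - x k.+1) ^+ 2
         + (2 * (beta k.+2)^-1 - (beta k.+1)^-1)
           * enorm (A *m (st k.+1 - x k.+1)) ^+ 2).
  have h := ccg_step Xconvex fpcc fsmooth gconv (iterate_in k) Xst xstarP.1
    d1 e0 e1 (ccg_beta_gt0 k.+2 delta_gt0 beta0_gt0) beta_le betaV_le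
    (proxkP k.+1) hp ora'.
  by rewrite /smoothed_gap xE; exact: h.
apply: (le_trans step) => {step}.
have -> : delta * ccg_eta delta k.+1 = 2 * delta / q.
  by rewrite etaE mulrCA mulrA.
have -> : ccg_eta delta k.+1 ^+ 2 / 2 = 2 / q ^+ 2 by rewrite etaE; field.
rewrite lerD2l ler_wpM2l ?divr_ge0 ?sqr_ge0// lerD//.
  exact: diameter_smooth_bound Xcompact fsmooth Xst (iterate_in k).
have -> : P * (2 * root k.+2 - root k.+1)
    = (2 * (beta k.+2)^-1 - (beta k.+1)^-1) * (spectral_norm A ^+ 2 * D ^+ 2).
  by rewrite !ccg_betaV; ring.
rewrite ler_wpM2l//.
  rewrite !ccg_betaV mulrA -mulrBl divr_ge0 ?(ltW beta0_gt0)// subr_ge0.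
  by rewrite (le_trans root_le)// ler_peMl ?ler1n// ltW.
apply: le_trans (enorm_mulmx_sqr_le _ _) _; rewrite ler_wpM2l ?sqr_ge0//.
have De : enorm (st k.+1 - x k.+1) <= D by exact: le_diameter (iterate_in k).
by rewrite lerXn2r// nnegrE ?enorm_ge0// (le_trans _ De) ?enorm_ge0.
Qed.

Lemma smoothed_gap_init : smoothed_gap 1 <= E.
Proof.
have := envelope_le (A *m x 1%N) (ccg_beta_gt0 1 delta_gt0 beta0_gt0)
  (proxkP 1).
rewrite initial_gapE /smoothed_gap {2}/envelope subrr enorm0 expr0n mulr0 addr0.
by rewrite lerD2r lerD2l.
Qed.

(** At [k = 0] the summand [delta * E / 2] alone accounts for the initial gap
    [E]: this is the reason for the term [delta * E] in the numerator. *)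
Lemma smoothed_gap_rate k :
  smoothed_gap k.+1 <= 2 / delta
    * ((D ^+ 2 * Lf + delta * E) / (delta * k%:R + 2) + P / root k.+1).
Proof.
have dE0 : 0 <= delta * E by rewrite mulr_ge0 ?initial_gap_ge0// ltW.
elim: k => [|k IH].
  apply: (le_trans smoothed_gap_init); rewrite mulr0 add0r.
  have {1}-> : E = 2 / delta * ((delta * E) / 2).
    by field; rewrite lt0r_neq0.
  rewrite ler_wpM2l ?divr_ge0 ?(ltW delta_gt0)//.
  rewrite -[leLHS]addr0 lerD//; last first.
    exact: divr_ge0 nonsmooth_const_ge0 (sqrtr_ge0 _).
  by rewrite ler_pM2r ?invr_gt0// lerDr.
have q2 : 2 <= delta * k%:R + 2 by rewrite lerDr scale_natr_ge0.
have sqr_root j : root j ^+ 2 = delta * j%:R + 1.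
  by rewrite sqr_sqrtr// addr_ge0// scale_natr_ge0.
have sE : root k.+1 ^+ 2 = delta * k%:R + 2 - 1 + delta.
  by rewrite sqr_root -[k.+1]addn1 natrD; ring.
have rE : root k.+2 ^+ 2 = delta * k%:R + 2 - 1 + 2 * delta.
  by rewrite sqr_root -[k.+2]addn2 natrD; ring.
have -> : delta * k.+1%:R + 2 = delta * k%:R + 2 + delta.
  by rewrite -[k.+1]addn1 natrD; ring.
apply: (rate_step delta_gt0 delta_le1 q2 _ _ sE rE _ _ _ IH
  (smoothed_gap_step k)).
- exact: ccg_sqrt_gt0.
- exact: ccg_sqrt_gt0.
- exact: addr_ge0.
- by rewrite lerDl.
- exact: nonsmooth_const_ge0.
Qed.

Lemma ccg_rate k :
  (objective f g A (x k.+1) - objective f g A xstar <=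
     (2 / delta * ((D ^+ 2 * Lf + delta * E) / (delta * k.+1%:R + 1)
                   + P / root k.+1) + beta k.+1 * Lg ^+ 2 / 2)%:E)%E.
Proof.
rewrite (objective_fin (iterate_in k)).
rewrite [X in (_ - X <= _)%E](objective_fin xstarP.1) -EFinB lee_fin.
have sm : gr (A *m x k.+1) <=
    envelope gr (beta k.+1) (A *m x k.+1) (proxk k.+1)
    + beta k.+1 * Lg ^+ 2 / 2.
  apply: le_envelope => [|u v]; first exact: ccg_beta_gt0.
  exact: lipschitz_real.
have C0 : 0 <= D ^+ 2 * Lf + delta * E.
  by rewrite addr_ge0// mulr_ge0 ?initial_gap_ge0// ltW.
have h : (D ^+ 2 * Lf + delta * E) / (delta * k%:R + 2)
    <= (D ^+ 2 * Lf + delta * E) / (delta * k.+1%:R + 1).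
  rewrite ler_wpM2l// lef_pV2 ?posrE ?ltr_wpDl ?scale_natr_ge0//.
  by have d1 := delta_le1; rewrite -[k.+1]addn1 natrD mulrDr mulr1; lra.
have rate := smoothed_gap_rate k; rewrite /smoothed_gap in rate.
have rate' : 2 / delta
    * ((D ^+ 2 * Lf + delta * E) / (delta * k%:R + 2) + P / root k.+1)
    <= 2 / delta
    * ((D ^+ 2 * Lf + delta * E) / (delta * k.+1%:R + 1) + P / root k.+1).
  by rewrite ler_wpM2l ?divr_ge0 ?(ltW delta_gt0)// lerD2r.
have := le_trans rate rate'.
rewrite lerBlDr => h2; rewrite lerBlDr.
rewrite (le_trans (lerD (lexx (fine (f (x k.+1)))) sm))//.
by rewrite addrA [leRHS]addrAC lerD2r.
Qed.

End Convergence.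

Theorem theorem4p5 (R : realType) (n d : nat) (X : set 'cV[R]_n)
    (f : 'cV[R]_n -> \bar R) (g : 'cV[R]_d -> \bar R) (A : 'M[R]_(d, n))
    (Lf Lg delta beta0 : R) (xstar : 'cV[R]_n) (x s st : nat -> 'cV[R]_n)
    (X0 : X !=set0) (Xcompact : compact X) (Xconvex : convex_set X)
    (fpcc : proper_closed_convex f) (fsmooth : smooth_on X f Lf)
    (gpcc : proper_closed_convex g) (gLip : lipschitz_fun g Lg)
    (xstarP : argmin X (objective f g A) xstar)
    (delta_gt0 : 0 < delta) (delta_le1 : delta <= 1) (beta0_gt0 : 0 < beta0)
    (run : ccg_mult X f g A delta beta0 x s st) :
  let F := objective f g A in
  let D := diameter X in
  let E := fine (F (x 1%N) - F xstar)%E in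
  let bound (b : R) (k : nat) :=
    2 / delta * ((D ^+ 2 * Lf + delta * E) / (delta * k%:R + 1)
                 + D ^+ 2 * spectral_norm A ^+ 2
                   / (b * Num.sqrt (delta * k%:R + 1)))
    + b * Lg ^+ 2 / (2 * Num.sqrt (delta * k%:R + 1)) in
  (forall k : nat, (1 <= k)%N ->
     (F (x k) - F xstar <= (bound beta0 k)%:E)%E) /\
  (* beta_0 can be optimized, uniformly in k, from delta and the constants *)
  (0 < D * spectral_norm A -> 0 < Lg ->
   exists2 b : R, 0 < b &
     forall (b' : R) (k : nat), 0 < b' -> (1 <= k)%N ->
       bound b k <= bound b' k).
Proof.
move=> F D E bound; split.
  case=> // k _; apply: (le_trans (ccg_rate Xcompact Xconvex fpcc fsmooth gpcc
    gLip xstarP delta_gt0 delta_le1 beta0_gt0 run k)).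
  rewrite lee_fin -/D -/E /bound /ccg_beta.
  move: (Num.sqrt _) => t; rewrite le_eqVlt; apply/orP; left; apply/eqP.
  by rewrite !invfM; ring.
move=> DA Lg0.
have [b b0 bopt] := optimal_smoothing delta_gt0 DA Lg0.
exists b => // b' k b'0 _.
have boundE c : bound c k =
    2 / delta * ((D ^+ 2 * Lf + delta * E) / (delta * k%:R + 1))
    + (2 / delta * ((D * spectral_norm A) ^+ 2 / c) + c * Lg ^+ 2 / 2)
      / Num.sqrt (delta * k%:R + 1).
  by rewrite /bound !invfM exprMn; ring.
rewrite !boundE lerD2l ler_pM2r ?bopt// invr_gt0.
exact: ccg_sqrt_gt0.
Qed.
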